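(* Let $\eta \in (0, 3^{1/4}\pi^{1/2})$. For any real $p<1$, there does not exist a constant $C>0$ such that \[ [\alpha_E(K)]^p \le C\,\delta_{wh}(K) \qquad \text{for all planar convex bodies } K\subset\mathbb{R}^2 \text{ with } \delta_{wh}(K)<\eta. \]
   Context: A convex body is a compact convex subset of $\mathbb{R}^2$ with non-empty interior. Triangles are regarded as closed filled triangles. The Cheeger constant of a convex body $K$ is \[ h(K)=\inf\left\{\frac{P(E)}{|E|} : E \text{ measurable},\ E\subseteq K,\ |E|>0\right\}, \] where $P(E)$ is the distributional (De Giorgi) perimeter and $|E|$ the Lebesgue measure. The minimal width of $K$ is $w(K)=\min_{\nu\in\mathbb{S}^{1}} w_\nu(K)$, where $w_\nu(K)=h_K(\nu)+h_K(-\nu)$ and $h_K(\nu)=\max_{x\in K} x\cdot\nu$. The width--Cheeger deficit of $K$ is \[ \delta_{wh}(K) = w(T_e)h(T_e) - w(K)h(K), \] where $T_e$ is any equilateral triangle (the product $w(T_e)h(T_e)$ does not depend on the choice of equilateral triangle and equals $3+\sqrt{\pi\sqrt3}$). The Hausdorff--width asymmetry of $K$ is \[ \alpha_E(K) = \inf\left\{\frac{d_H(K, T)}{w(K)} : T\subset\mathbb{R}^2 \text{ an equilateral triangle with } w(T)=w(K)\right\}, \] where $d_H$ denotes the Hausdorff distance. *)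

(* Defs.v *)
From HB Require Import structures.
From mathcomp Require Import all_boot all_order all_algebra.
From mathcomp Require Import all_classical all_reals all_analysis.

Set Implicit Arguments.
Unset Strict Implicit.
Unset Printing Implicit Defensive.

Import Order.TTheory GRing.Theory Num.Theory.
Import numFieldNormedType.Exports.

Local Open Scope classical_set_scope.
Local Open Scope ring_scope.

(* The library norm on a product is the sup norm: it gives the right topology,
   compactness and differentiability, but every metric notion below uses the
   Euclidean norm [enorm]. *)
Definition plane (R : realType) : normedModType R := (R * R)%type.

Definition dotp (R : realType) (x y : plane R) : R := x.1 * y.1 + x.2 * y.2.

Definition enorm (R : realType) (x : plane R) : R := Num.sqrt (dotp x x).

Definition borel_lebesgue2 (R : realType) :
    {measure set (measurableTypeR R * measurableTypeR R) -> \bar R} :=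
  (@lebesgue_measure R \x @lebesgue_measure R)%E.

(* The plane with the Lebesgue (rather than Borel) measurable sets, i.e. the
   Caratheodory sigma-algebra of the outer measure of [borel_lebesgue2]. *)
Definition lebesgue_plane (R : realType) : measurableType _ :=
  caratheodory_type ((borel_lebesgue2 R)^*)%mu.

Definition lebesgue2 (R : realType) : {measure set (lebesgue_plane R) -> \bar R} :=
  @completed_measure_extension _ _ R (borel_lebesgue2 R).

Definition is_C1 (R : realType) (f : plane R -> R) : Prop :=
  [/\ forall x, differentiable f x,
      continuous ('D_((1, 0) : plane R) f) &
      continuous ('D_((0, 1) : plane R) f)].

Definition divergence (R : realType) (phi : plane R -> plane R) (x : plane R) : R :=
  'D_((1, 0) : plane R) (fun y => (phi y).1) x +
  'D_((0, 1) : plane R) (fun y => (phi y).2) x.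

Definition test_field (R : realType) : set (plane R -> plane R) :=
  [set phi | [/\ is_C1 (fun x => (phi x).1), is_C1 (fun x => (phi x).2),
                 compact (closure [set x | phi x != 0]) &
                 forall x, enorm (phi x) <= 1]].

Definition perimeter (R : realType) (E : set (plane R)) : \bar R :=
  ereal_sup [set (\int[@lebesgue2 R]_(x in E) (divergence phi x)%:E)%E
            | phi in @test_field R].

Definition cheeger (R : realType) (K : set (plane R)) : \bar R :=
  ereal_inf [set (perimeter E / lebesgue2 R E)%E
            | E in [set E : set (lebesgue_plane R) |
                     [/\ measurable E, E `<=` K & (0 < lebesgue2 R E)%E]]].

Definition convex_body (R : realType) (K : set (plane R)) : Prop :=
  [/\ compact K, convex_set K & interior K !=set0].

Definition support_fun (R : realType) (K : set (plane R)) (nu : plane R) : R :=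
  sup [set dotp x nu | x in K].

Definition width_dir (R : realType) (nu : plane R) (K : set (plane R)) : R :=
  support_fun K nu + support_fun K (- nu).

Definition width (R : realType) (K : set (plane R)) : R :=
  inf [set width_dir nu K | nu in [set nu | enorm nu = 1]].

Definition triangle (R : realType) (a b c : plane R) : set (plane R) :=
  [set x | exists s t u : R, [/\ 0 <= s, 0 <= t, 0 <= u, s + t + u = 1 &
             x = s *: a + t *: b + u *: c]].

Definition equilateral_triangle (R : realType) (T : set (plane R)) : Prop :=
  exists a b c : plane R,
    [/\ 0 < enorm (a - b), enorm (b - c) = enorm (a - b),
        enorm (c - a) = enorm (a - b) & T = triangle a b c].

Definition hausdorff_dist (R : realType) (A B : set (plane R)) : R :=
  Num.max (sup [set inf [set enorm (x - y) | y in B] | x in A])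
          (sup [set inf [set enorm (x - y) | x in A] | y in B]).

(* [Te] is the reference equilateral triangle. The value is real for convex
   bodies, whose Cheeger constant is finite. *)
Definition width_cheeger_deficit (R : realType) (Te K : set (plane R)) : \bar R :=
  ((width Te)%:E * cheeger Te - (width K)%:E * cheeger K)%E.

Definition hausdorff_width_asymmetry (R : realType) (K : set (plane R)) : R :=
  inf [set hausdorff_dist K T / width K
      | T in [set T | equilateral_triangle T /\ width T = width K]].

(* Main.v *)
Require Import Defs.
From mathcomp Require Import all_boot all_order all_algebra.
From mathcomp Require Import all_classical all_reals all_analysis.
From mathcomp Require Import ring lra.

Set Implicit Arguments.
Unset Strict Implicit.
Unset Printing Implicit Defensive.

Import Order.TTheory GRing.Theory Num.Theory.
Import numFieldNormedType.Exports.

Local Open Scope classical_set_scope.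
Local Open Scope ring_scope.

(** Let [Te] be the triangle [a b c] of side [s] and move the apex [c] along the
    side [ca] to [c' = (1 - e) c + e a].  The triangle [K = a b c'] contains the
    copy of [Te] contracted by [1 - e] towards [a], and its height above [ab] is
    [1 - e] times that of [Te], so [w(K) = (1 - e) w(Te)].  As [K] is a subset of
    [Te], [h(K) >= h(Te)], and the deficit of [K] is at most [e w(Te) h(Te)].  On
    the other hand [K] still contains a segment [ab] of length [s], whereas an
    equilateral triangle of width [w(K)] has diameter [(1 - e) s]: the asymmetry
    of [K] is bounded below by a multiple of [e].  Let [e] tend to [0]; for
    [p < 0] an upper bound on the asymmetry is enough. *)

(** * Euclidean geometry of the plane in coordinates *)

Lemma plane_eq (R : realType) (x y : plane R) : x.1 = y.1 -> x.2 = y.2 -> x = y.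
Proof. by case: x y => [x1 x2] [y1 y2] /= -> ->. Qed.

Lemma plane_fstZ (R : realType) (k : R) (x : plane R) : (k *: x).1 = k * x.1.
Proof. by []. Qed.

Lemma plane_sndZ (R : realType) (k : R) (x : plane R) : (k *: x).2 = k * x.2.
Proof. by []. Qed.

Definition plane_coordE (R : realType) :=
  (@plane_fstZ R, @plane_sndZ R,
   (fun x y : plane R => erefl : (x + y).1 = x.1 + y.1 :> R),
   (fun x y : plane R => erefl : (x + y).2 = x.2 + y.2 :> R),
   (fun x : plane R => erefl : (- x).1 = - x.1 :> R),
   (fun x : plane R => erefl : (- x).2 = - x.2 :> R)).

Lemma dotpDl (R : realType) (x y z : plane R) :
  dotp (x + y) z = dotp x z + dotp y z.
Proof. rewrite /dotp !plane_coordE; ring. Qed.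

Lemma dotpNl (R : realType) (x z : plane R) : dotp (- x) z = - dotp x z.
Proof. rewrite /dotp !plane_coordE; ring. Qed.

Lemma dotpZl (R : realType) (k : R) (x z : plane R) :
  dotp (k *: x) z = k * dotp x z.
Proof. rewrite /dotp !plane_coordE; ring. Qed.

Lemma dotpC (R : realType) (x y : plane R) : dotp x y = dotp y x.
Proof. rewrite /dotp; ring. Qed.

Definition dotpE (R : realType) := (@dotpDl R, @dotpNl R, @dotpZl R).

Lemma dotp_ge0 (R : realType) (x : plane R) : 0 <= dotp x x.
Proof. rewrite /dotp; nra. Qed.

Lemma enorm_ge0 (R : realType) (x : plane R) : 0 <= enorm x.
Proof. exact: sqrtr_ge0. Qed.

Lemma sqr_enorm (R : realType) (x : plane R) : enorm x ^+ 2 = dotp x x.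
Proof. by rewrite sqr_sqrtr ?dotp_ge0. Qed.

Lemma enorm_leP (R : realType) (x : plane R) (r : R) :
  0 <= r -> (enorm x <= r) = (dotp x x <= r ^+ 2).
Proof. by move=> r0; rewrite -sqr_enorm ler_sqr ?nnegrE// enorm_ge0. Qed.

Lemma enorm_eq (R : realType) (x : plane R) (r : R) :
  0 <= r -> dotp x x = r ^+ 2 -> enorm x = r.
Proof. by move=> r0 h; rewrite /enorm h sqrtr_sqr ger0_norm. Qed.

Lemma enormN (R : realType) (x : plane R) : enorm (- x) = enorm x.
Proof. by congr Num.sqrt; rewrite !dotpE dotpC !dotpE opprK. Qed.

Lemma enormB (R : realType) (x y : plane R) : enorm (x - y) = enorm (y - x).
Proof. by rewrite -enormN opprB. Qed.

Lemma enormZ (R : realType) (k : R) (x : plane R) :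
  0 <= k -> enorm (k *: x) = k * enorm x.
Proof.
move=> k0; apply: enorm_eq; first by rewrite mulr_ge0 ?enorm_ge0.
rewrite exprMn sqr_enorm !dotpE dotpC !dotpE; ring.
Qed.

(** Cauchy-Schwarz: after squaring, the gap between the two sides is the square of the determinant
    of [x] and [y]. *)
Lemma dotp_le_enorm (R : realType) (x y : plane R) :
  dotp x y <= enorm x * enorm y.
Proof.
have [h|h] := leP (dotp x y) 0.
  by rewrite (le_trans h)// mulr_ge0 ?enorm_ge0.
rewrite -ler_sqr ?nnegrE ?mulr_ge0 ?enorm_ge0 ?(ltW h)//.
rewrite exprMn !sqr_enorm /dotp.
rewrite -subr_ge0 (_ : _ - _ = (x.1 * y.2 - x.2 * y.1) ^+ 2) ?sqr_ge0//; ring.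
Qed.

Lemma enormD (R : realType) (x y : plane R) : enorm (x + y) <= enorm x + enorm y.
Proof.
rewrite enorm_leP ?addr_ge0 ?enorm_ge0// !dotpE ![dotp _ (x + y)]dotpC !dotpE.
rewrite sqrrD !sqr_enorm (dotpC y x).
by have := dotp_le_enorm x y; lra.
Qed.

(** * Filled triangles: convexity, diameter, compactness, interior *)

Lemma triangle_mem1 (R : realType) (a b c : plane R) : triangle a b c a.
Proof.
by exists 1, 0, 0; split; rewrite ?addr0 ?scale1r ?scale0r ?addr0//.
Qed.

Lemma triangle_mem2 (R : realType) (a b c : plane R) : triangle a b c b.
Proof.
by exists 0, 1, 0; split; rewrite ?addr0 ?scale1r ?scale0r ?addr0 ?add0r//.
Qed.

Lemma triangle_mem3 (R : realType) (a b c : plane R) : triangle a b c c.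
Proof.
by exists 0, 0, 1; split; rewrite ?addr0 ?scale1r ?scale0r ?addr0 ?add0r//.
Qed.

Lemma triangle_convex (R : realType) (a b c x y : plane R) (k : R) :
  0 <= k -> k <= 1 -> triangle a b c x -> triangle a b c y ->
  triangle a b c (k *: x + (1 - k) *: y).
Proof.
move=> k0 k1 [s [t [u [s0 t0 u0 e ->]]]] [s' [t' [u' [s'0 t'0 u'0 e' ->]]]].
have k1' : 0 <= 1 - k by rewrite subr_ge0.
exists (k * s + (1 - k) * s'), (k * t + (1 - k) * t'), (k * u + (1 - k) * u').
split; rewrite ?addr_ge0 ?mulr_ge0//.
  transitivity (k * (s + t + u) + (1 - k) * (s' + t' + u')); first by ring.
  by rewrite e e'; ring.
by apply: plane_eq; rewrite !plane_coordE; ring.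
Qed.

Lemma triangle_subset (R : realType) (a b c x y z : plane R) :
  triangle a b c x -> triangle a b c y -> triangle a b c z ->
  triangle x y z `<=` triangle a b c.
Proof.
move=> [x1 [x2 [x3 [x10 x20 x30 ex ->]]]] [y1 [y2 [y3 [y10 y20 y30 ey ->]]]].
move=> [z1 [z2 [z3 [z10 z20 z30 ez ->]]]] _ [s [t [u [s0 t0 u0 e ->]]]].
exists (s * x1 + t * y1 + u * z1), (s * x2 + t * y2 + u * z2),
  (s * x3 + t * y3 + u * z3).
split; rewrite ?addr_ge0 ?mulr_ge0//.
  transitivity (s * (x1 + x2 + x3) + t * (y1 + y2 + y3) + u * (z1 + z2 + z3)).
    by ring.
  by rewrite ex ey ez !mulr1.
by apply: plane_eq; rewrite !plane_coordE; ring.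
Qed.

Lemma triangle_dotp_le (R : realType) (a b c nu x : plane R) (m : R) :
  dotp a nu <= m -> dotp b nu <= m -> dotp c nu <= m ->
  triangle a b c x -> dotp x nu <= m.
Proof.
move=> am bm cm [s [t [u [s0 t0 u0 e ->]]]]; rewrite !dotpE.
have -> : m = s * m + t * m + u * m by rewrite -!mulrDl e mul1r.
by rewrite !lerD// ler_wpM2l.
Qed.

(** The distance to [x] is a convex function, so on a triangle it is largest at a vertex. *)
Lemma triangle_enorm_le (R : realType) (a b c x y : plane R) (m : R) :
  enorm (x - a) <= m -> enorm (x - b) <= m -> enorm (x - c) <= m ->
  triangle a b c y -> enorm (x - y) <= m.
Proof.
move=> am bm cm [s [t [u [s0 t0 u0 e ->]]]].
have -> : x - (s *: a + t *: b + u *: c) =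
    s *: (x - a) + t *: (x - b) + u *: (x - c).
  rewrite (_ : u = 1 - s - t); last by rewrite -e; ring.
  by apply: plane_eq; rewrite !plane_coordE; ring.
have -> : m = s * m + t * m + u * m by rewrite -!mulrDl e mul1r.
rewrite (le_trans (enormD _ _))// lerD//.
  by rewrite (le_trans (enormD _ _))// lerD// enormZ// ler_wpM2l.
by rewrite enormZ// ler_wpM2l.
Qed.

Lemma triangle_diam_le (R : realType) (a b c x y : plane R) (m : R) :
  enorm (a - b) <= m -> enorm (b - c) <= m -> enorm (c - a) <= m ->
  triangle a b c x -> triangle a b c y -> enorm (x - y) <= m.
Proof.
move=> ab bc ca hx hy.
have m0 : 0 <= m by rewrite (le_trans _ ab) ?enorm_ge0.
have zz z : enorm (z - z) <= m.
  by rewrite subrr enorm_leP// /dotp !mul0r addr0 sqr_ge0.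
by apply: triangle_enorm_le hy; rewrite enormB;
  apply: triangle_enorm_le hx; rewrite ?zz // enormB.
Qed.

Lemma triangle_compact (R : realType) (a b c : plane R) :
  compact (triangle a b c).
Proof.
(* The triangle is a continuous image of the unit square: [q.2] selects a point of the side [bc],
   and [q.1] a point of the segment from [a] to it. *)
pose f (q : R * R) : plane R :=
  (1 - q.1) *: a + (q.1 * (1 - q.2)) *: b + (q.1 * q.2) *: c.
have -> : triangle a b c = f @` (`[0, 1] `*` `[0, 1]).
  apply/seteqP; split => [_ [s [t [u [s0 t0 u0 e ->]]]]|x [[q1 q2]]] /=.
    (* If [t + u = 0] the point is [a]; the quotient is then [0] by the convention on inverses,
       which still lies in [[0, 1]]. *)
    exists (t + u, u / (t + u)).
      rewrite /= !in_itv/=; split; first by apply/andP; split; lra.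
      have [/eqP|tu] := eqVneq (t + u) 0.
        by move=> /eqP ->; rewrite invr0 mulr0 lexx ler01.
      have tu0 : 0 < t + u by rewrite lt_neqAle eq_sym tu addr_ge0.
      by rewrite divr_ge0 ?addr_ge0// ler_pdivrMr// mul1r lerDr.
    rewrite /f /=; have -> : (t + u) * (u / (t + u)) = u.
      have [tu|tu] := eqVneq (t + u) 0; last by field.
      by rewrite tu mul0r; lra.
    have -> : (t + u) * (1 - u / (t + u)) = t.
      have [tu|tu] := eqVneq (t + u) 0; last by field.
      by rewrite tu mul0r; lra.
    by rewrite (_ : 1 - (t + u) = s)//; lra.
  rewrite !in_itv/= => -[/andP[q10 q11] /andP[q20 q21]] <-.
  exists (1 - q1), (q1 * (1 - q2)), (q1 * q2).
  by split; rewrite ?mulr_ge0 ?subr_ge0//; ring.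
apply: continuous_compact; last first.
  by apply: compact_setX; exact: segment_compact.
apply: continuous_subspaceT => q.
have c1 : {for q, continuous (fun q : R * R => q.1)} by exact: cvg_fst.
have c2 : {for q, continuous (fun q : R * R => q.2)} by exact: cvg_snd.
have cc k : {for q, continuous (fun _ : R * R => k : R)} by exact: cvg_cst.
by apply: cvgD; [apply: cvgD|]; apply: cvgZr_tmp;
  [apply: cvgB; [exact: cc|exact: c1]
  |apply: cvgM; [exact: c1|apply: cvgB; [exact: cc|exact: c2]]
  |apply: cvgM; [exact: c1|exact: c2]].
Qed.

Definition cross (R : realType) (x y : plane R) : R := x.1 * y.2 - x.2 * y.1.

Lemma continuous_cross (R : realType) (a y : plane R) (k : R) :
  continuous (fun x : plane R => cross (x - a) y / k).
Proof.
move=> x.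
have c1 : {for x, continuous (fun q : plane R => q.1)} by exact: cvg_fst.
have c2 : {for x, continuous (fun q : plane R => q.2)} by exact: cvg_snd.
have cc z : {for x, continuous (fun _ : plane R => z : R)} by exact: cvg_cst.
rewrite /cross /=.
by apply: cvgM; [apply: cvgB; apply: cvgM; [apply: cvgB; [exact: c1|exact: cc]
  |exact: cc|apply: cvgB; [exact: c2|exact: cc]|exact: cc]|exact: cc].
Qed.

Lemma triangle_interior (R : realType) (a b c : plane R) :
  cross (b - a) (c - a) != 0 -> interior (triangle a b c) !=set0.
Proof.
set D := cross _ _ => D0.
(* Cramer's rule: [f] and [g] are the barycentric coordinates of [x] at [b] and [c]. The open set
   [U] where all three coordinates are positive contains the centroid. *)
pose f x := cross (x - a) (c - a) / D.
pose g x := cross (x - a) (b - a) / - D.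
have fgE x : x = (1 - (f x + g x)) *: a + f x *: b + g x *: c.
  move: D0; rewrite /f /g /D /cross !plane_coordE => D0.
  by apply: plane_eq; rewrite !plane_coordE; field; rewrite ?oppr_eq0 D0.
have cf : continuous f by exact: continuous_cross.
have cg : continuous g by exact: continuous_cross.
have cfg : continuous (fun x => f x + g x).
  by move=> x; apply: cvgD; [exact: cf|exact: cg].
pose U := f @^-1` [set r | 0 < r] `&` g @^-1` [set r | 0 < r] `&`
  (fun x => f x + g x) @^-1` [set r | r < 1].
have oU : open U.
  apply: openI; first apply: openI; apply: open_comp => //;
    by [exact: open_gt|exact: open_lt].
have UT : U `<=` triangle a b c.
  move=> x [[/= f0 g0] fg1]; exists (1 - (f x + g x)), (f x), (g x).
  split; [by rewrite subr_ge0 ltW|exact: ltW|exact: ltW|by ring|exact: fgE].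
exists (3^-1 *: (a + b + c)); move: UT; rewrite open_subsetE//; apply.
have fE : f (3^-1 *: (a + b + c)) = 3^-1.
  move: D0; rewrite /f /D /cross !plane_coordE => D0; by field.
have gE : g (3^-1 *: (a + b + c)) = 3^-1.
  move: D0; rewrite /g /D /cross !plane_coordE => D0.
  by field; rewrite ?oppr_eq0 D0.
by rewrite /U /= fE gE; split; [split|]; lra.
Qed.

Lemma triangle_convex_body (R : realType) (a b c : plane R) :
  cross (b - a) (c - a) != 0 -> convex_body (triangle a b c).
Proof.
move=> D0; split; [exact: triangle_compact| |exact: triangle_interior].
move=> x y k /set_mem hx /set_mem hy; apply/mem_set.
exact: triangle_convex.
Qed.

(** * Support functions and directional widths of triangles *)

Lemma support_fun_ge (R : realType) (a b c nu x : plane R) :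
  triangle a b c x -> dotp x nu <= support_fun (triangle a b c) nu.
Proof.
move=> hx; apply: ub_le_sup; last by exists x.
exists (Num.max (dotp a nu) (Num.max (dotp b nu) (dotp c nu))) => _ [y hy <-].
by apply: triangle_dotp_le hy; rewrite !le_max lexx ?orbT.
Qed.

Lemma support_fun_le (R : realType) (a b c nu : plane R) (m : R) :
  dotp a nu <= m -> dotp b nu <= m -> dotp c nu <= m ->
  support_fun (triangle a b c) nu <= m.
Proof.
move=> am bm cm; apply: ge_sup.
  by exists (dotp a nu), a => //; exact: triangle_mem1.
by move=> _ [y hy <-]; exact: triangle_dotp_le hy.
Qed.

Lemma dotp_le_width_dir (R : realType) (a b c nu x y : plane R) :
  triangle a b c x -> triangle a b c y ->
  dotp x nu - dotp y nu <= width_dir nu (triangle a b c).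
Proof.
move=> hx hy; rewrite /width_dir -[- dotp y nu]dotpNl.
have -> : dotp (- y) nu = dotp y (- nu) by rewrite dotpNl dotpC -dotpNl dotpC.
by rewrite lerD// support_fun_ge.
Qed.

(** * Equilateral triangles: scalar products of the sides and a width bound *)

Definition equilateral (R : realType) (a b c : plane R) (s : R) : Prop :=
  [/\ 0 < s, enorm (a - b) = s, enorm (b - c) = s & enorm (c - a) = s].

Lemma equilateral_dotp (R : realType) (a b c : plane R) (s : R) :
  equilateral a b c s ->
  [/\ dotp (b - a) (b - a) = s ^+ 2, dotp (c - a) (c - a) = s ^+ 2 &
      dotp (b - a) (c - a) = s ^+ 2 / 2].
Proof.
move=> [s0 /(congr1 (fun r => r ^+ 2)) ab /(congr1 (fun r => r ^+ 2)) bc].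
move=> /(congr1 (fun r => r ^+ 2)) ca; move: ab bc ca; rewrite !sqr_enorm.
rewrite /dotp !plane_coordE; split; lra.
Qed.

(* Lagrange's identity for the Gram matrix of the two sides issued from [a]. *)
Lemma equilateral_gram (R : realType) (a b c nu : plane R) (s : R) :
  equilateral a b c s -> enorm nu = 1 ->
  dotp (b - a) nu ^+ 2 - dotp (b - a) nu * dotp (c - a) nu
    + dotp (c - a) nu ^+ 2 = 3 / 4 * s ^+ 2.
Proof.
move=> abc /(congr1 (fun r => r ^+ 2)); rewrite sqr_enorm expr1n => nu1.
have [uu vv uv] := equilateral_dotp abc; have [s0 _ _ _] := abc.
have s2 : s ^+ 2 != 0 by rewrite expf_neq0// gt_eqF.
(* With [u = b - a] and [v = c - a], multiplying by [s ^+ 2] turns the left side into the squared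
   norm of [(u.nu) v - (v.nu) u]. *)
apply: (mulfI s2).
move: (b - a) (c - a) uu vv uv => u v uu vv uv.
transitivity (dotp v v * dotp u nu ^+ 2
    - 2 * dotp u v * (dotp u nu * dotp v nu) + dotp u u * dotp v nu ^+ 2).
  by rewrite uu vv uv; field.
transitivity (dotp nu nu * (dotp u u * dotp v v - dotp u v ^+ 2)).
  by rewrite /dotp; ring.
by rewrite nu1 uu vv uv; field.
Qed.

Lemma equilateral_cross (R : realType) (a b c : plane R) (s : R) :
  equilateral a b c s -> cross (b - a) (c - a) ^+ 2 = 3 / 4 * (s ^+ 2) ^+ 2.
Proof.
move=> /equilateral_dotp; move: (b - a) (c - a) => u v [uu vv uv].
transitivity (dotp u u * dotp v v - dotp u v ^+ 2).
  by rewrite /dotp /cross; ring.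
by rewrite uu vv uv; field.
Qed.

(** The width [W] of [pqr] along [nu] dominates the projections of all three sides of [abc], and
    these are tied to [s] by the Gram identity. *)
Lemma equilateral_width_dir_ge (R : realType) (a b c p q r nu : plane R) (s : R) :
  equilateral a b c s -> triangle p q r a -> triangle p q r b ->
  triangle p q r c -> enorm nu = 1 ->
  Num.sqrt 3 / 2 * s <= width_dir nu (triangle p q r).
Proof.
move=> abc ha hb hc nu1; have := equilateral_gram abc nu1.
have le x y := @dotp_le_width_dir R p q r nu x y.
have := (le _ _ ha hb, le _ _ hb ha, le _ _ hb hc, le _ _ hc hb, le _ _ ha hc,
  le _ _ hc ha, le _ _ ha ha).
rewrite !dotpE; set W := width_dir _ _.
move: (dotp a nu) (dotp b nu) (dotp c nu) => x y z.
move=> [[[[[[xy yx] yz] zy] xz] zx] xx] gram.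
have W0 : 0 <= W by lra.
have s0 : 0 <= s by case: abc => /ltW.
rewrite -ler_sqr ?nnegrE ?mulr_ge0 ?divr_ge0 ?sqrtr_ge0//.
rewrite exprMn exprMn sqr_sqrtr//.
have -> : 3 * 2^-1 ^+ 2 * s ^+ 2 = 3 / 4 * s ^+ 2 by field.
rewrite -gram.
have sq t : t <= W -> - t <= W -> t ^+ 2 <= W ^+ 2.
  by move=> t1 t2; nra.
have sy := sq (y - x) ltac:(lra) ltac:(lra).
have sz := sq (z - x) ltac:(lra) ltac:(lra).
have syz := sq (y - z) ltac:(lra) ltac:(lra).
(* Put [u = y - x] and [v = z - x]. If [u v < 0], then [u^2 - u v + v^2] is at most [(u - v)^2];
   otherwise it is at most the larger of [u^2] and [v^2]. *)
have [yz0|yz0] := leP 0 ((y - x) * (z - x)); last by nra.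
have [h|h] := leP (z - x) (y - x); have [h'|h'] := leP 0 (y - x); nra.
Qed.

(** * The clipped triangle, with [k] in the role of [1 - e] *)

Section clipped_triangle.
Variables (R : realType) (a b c : plane R) (s k : R).
Hypotheses (abc : equilateral a b c s) (k0 : 0 < k) (k1 : k <= 1).

(** The homothety of ratio [k] centred at [a]. It moves only the apex of [K], while applied to all
    of [abc] it gives the equilateral triangle inscribed in [K]. *)
Let ctr (x : plane R) : plane R := k *: x + (1 - k) *: a.

Let K := triangle a b (ctr c).

Let ctrB x y : ctr x - ctr y = k *: (x - y).
Proof. by apply: plane_eq; rewrite !plane_coordE; ring. Qed.

Let ctra : ctr a = a.
Proof. by apply: plane_eq; rewrite !plane_coordE; ring. Qed.

Lemma equilateral_contraction : equilateral a (ctr b) (ctr c) (k * s).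
Proof.
have [s0 ab bc ca] := abc; rewrite -[X in equilateral X]ctra.
by split; rewrite ?mulr_gt0// ctrB enormZ ?ltW// ?ab ?bc ?ca.
Qed.

Let Kb : K (ctr b).
Proof.
by apply: triangle_convex; [exact: ltW|by []|exact: triangle_mem2
  |exact: triangle_mem1].
Qed.

Lemma clipped_triangle_subset : K `<=` triangle a b c.
Proof.
apply: triangle_subset; [exact: triangle_mem1|exact: triangle_mem2|].
by apply: triangle_convex; [exact: ltW|by []|exact: triangle_mem3
  |exact: triangle_mem1].
Qed.

(** The contracted equilateral triangle inside [K] bounds every directional width from below; the
    direction normal to [ab] attains the bound. *)
Lemma clipped_triangle_width : width K = k * (Num.sqrt 3 / 2 * s).
Proof.
have [s0 _ _ _] := abc; have ks0 := mulr_gt0 k0 s0.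
have ge nu : enorm nu = 1 -> k * (Num.sqrt 3 / 2 * s) <= width_dir nu K.
  rewrite mulrCA => nu1.
  apply: (equilateral_width_dir_ge equilateral_contraction) => //.
    exact: triangle_mem1.
  exact: triangle_mem3.
have [uu vv uv] := equilateral_dotp abc.
(* The unit normal to [ab]: the vector [(b - a) / s] turned by a right angle. *)
pose nu : plane R := (- (b - a).2 / s, (b - a).1 / s).
have snz : s != 0 by rewrite gt_eqF.
have nu1 : enorm nu = 1.
  apply: enorm_eq => //; rewrite expr1n.
  have -> : dotp nu nu = dotp (b - a) (b - a) / s ^+ 2.
    by rewrite /dotp /=; field.
  by rewrite uu divff// expf_neq0.
have unu : dotp b nu = dotp a nu.
  apply/eqP; rewrite -subr_eq0 -dotpNl -dotpDl /dotp /=; apply/eqP; field => //.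
apply/eqP; rewrite eq_le; apply/andP; split; last first.
  apply: lb_le_inf; first by exists (width_dir nu K), nu.
  by move=> _ [nu' nu'1 <-]; exact: ge.
apply: (@le_trans _ _ (width_dir nu K)).
  apply: ge_inf; last by exists nu.
  by exists (k * (Num.sqrt 3 / 2 * s)) => _ [nu' nu'1 <-]; exact: ge.
have /eqP := equilateral_gram abc nu1.
rewrite !dotpDl !dotpNl unu subrr expr0n/= mul0r subr0 add0r.
set h := Num.sqrt 3 / 2 * s.
have -> : 3 / 4 * s ^+ 2 = h ^+ 2.
  by rewrite /h !exprMn sqr_sqrtr//; field.
have h0 : 0 <= h by rewrite !mulr_ge0 ?sqrtr_ge0// ltW.
have cE : dotp (ctr c) nu = dotp a nu + k * (dotp c nu - dotp a nu).
  by rewrite /ctr !dotpE; ring.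
have dotpNr x : dotp x (- nu) = - dotp x nu.
  by rewrite dotpC dotpNl dotpC.
(* The Gram identity fixes the height of [c] above [ab] only up to sign; the two cases are the two
   orientations of [abc]. *)
rewrite eqf_sqr => /orP[] /eqP e; rewrite e in cE; rewrite /width_dir.
  have -> : k * h = (dotp a nu + k * h) + (- dotp a nu) by ring.
  have kh : 0 <= k * h by rewrite mulr_ge0// ltW.
  by rewrite lerD// support_fun_le// ?dotpNr ?unu ?cE; lra.
have -> : k * h = dotp a nu + (k * h - dotp a nu) by ring.
have kh : 0 <= k * h by rewrite mulr_ge0// ltW.
by rewrite lerD// support_fun_le// ?dotpNr ?unu ?cE; lra.
Qed.

Lemma clipped_triangle_convex_body : convex_body K.
Proof.
apply: triangle_convex_body.
have -> : cross (b - a) (ctr c - a) = k * cross (b - a) (c - a).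
  by rewrite /cross /ctr !plane_coordE; ring.
rewrite mulf_neq0 ?(gt_eqF k0)// -sqrf_eq0 (equilateral_cross abc).
by have [s0 _ _ _] := abc; rewrite gt_eqF// mulr_gt0 ?exprn_gt0// divr_gt0.
Qed.

End clipped_triangle.

(** * Hausdorff distance and asymmetry of the clipped triangle *)

Lemma hausdorff_dist_ge (R : realType) (p q r x y : plane R) (T : set (plane R))
    (m : R) :
  T !=set0 -> (forall z w, T z -> T w -> enorm (z - w) <= m) ->
  triangle p q r x -> triangle p q r y ->
  enorm (x - y) <= m + 2 * hausdorff_dist (triangle p q r) T.
Proof.
move=> [t Tt] Tm hx hy; set d := hausdorff_dist _ _.
have inf_le_d z : triangle p q r z -> inf [set enorm (z - w) | w in T] <= d.
  move=> hz; rewrite /d /hausdorff_dist le_max; apply/orP; left.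
  apply: ub_le_sup; last by exists z.
  (* The supremum dominates its elements only once the set is known to be bounded: distances to [T]
     are at most the distance from [t] to the farthest vertex. *)
  exists (Num.max (enorm (t - p)) (Num.max (enorm (t - q)) (enorm (t - r)))).
  move=> _ [w hw <-]; apply: (@le_trans _ _ (enorm (w - t))).
    by apply: ge_inf; [exists 0 => _ [? _ <-]; exact: enorm_ge0|exists t].
  by rewrite enormB; apply: triangle_enorm_le hw; rewrite !le_max lexx ?orbT.
(* The infimum defining the distance to [T] need not be attained, so [x] and [y] are approximated by
   [x'] and [y'] in [T] up to [eps / 2] each; the path through [x'] and [y'] gives the bound. *)
apply/ler_addgt0Pr => eps eps0.
have near z : triangle p q r z -> exists2 w, T w & enorm (z - w) < d + eps / 2.
  move=> hz; have inf_lt : inf [set enorm (z - w) | w in T] < d + eps / 2.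
    by rewrite (le_lt_trans (inf_le_d z hz))// ltrDl divr_gt0.
  have [||_ [w Tw <-] zw] := @inf_adherent R [set enorm (z - w) | w in T]
      (d + eps / 2 - inf [set enorm (z - w) | w in T]); first by rewrite subr_gt0.
    by split; [exists (enorm (z - t)), t|exists 0 => _ [? _ <-]; exact: enorm_ge0].
  by exists w => //; move: zw; rewrite [ltRHS]addrC subrK.
have [x' Tx xx'] := near x hx; have [y' Ty yy'] := near y hy.
have -> : x - y = (x - x') + ((x' - y') + (y' - y)).
  by apply: plane_eq; rewrite !plane_coordE; ring.
have := enormD (x - x') ((x' - y') + (y' - y)).
have := enormD (x' - y') (y' - y); have := Tm _ _ Tx Ty.
by rewrite enormB in yy'; lra.
Qed.

Lemma hausdorff_dist_le (R : realType) (A B : set (plane R)) (m : R) :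
  A !=set0 -> B !=set0 -> (forall x y, A x -> B y -> enorm (x - y) <= m) ->
  hausdorff_dist A B <= m.
Proof.
move=> [a Aa] [b Bb] ABm; rewrite /hausdorff_dist ge_max; apply/andP; split.
  apply: ge_sup; first by exists (inf [set enorm (a - y) | y in B]), a.
  move=> _ [x Ax <-]; apply: le_trans (ABm _ _ Ax Bb).
  by apply: ge_inf; [exists 0 => _ [? _ <-]; exact: enorm_ge0|exists b].
apply: ge_sup; first by exists (inf [set enorm (x - b) | x in A]), b.
move=> _ [y By <-]; apply: le_trans (ABm _ _ Aa By).
by apply: ge_inf; [exists 0 => _ [? _ <-]; exact: enorm_ge0|exists a].
Qed.

Lemma equilateral_triangleP (R : realType) (T : set (plane R)) :
  equilateral_triangle T <->
  exists a b c s, equilateral a b c s /\ T = triangle a b c.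
Proof.
split; last by move=> [a [b [c [s [[s0 ab bc ca] ->]]]]];
  exists a, b, c; split; rewrite ?ab.
by move=> [a [b [c [ab bc ca ->]]]]; exists a, b, c, (enorm (a - b)).
Qed.

(** The case [k = 1] of the clipped triangle. *)
Lemma equilateral_width (R : realType) (a b c : plane R) (s : R) :
  equilateral a b c s -> width (triangle a b c) = Num.sqrt 3 / 2 * s.
Proof.
move=> abc; have := @clipped_triangle_width R a b c s 1 abc ltr01 (lexx 1).
by rewrite scale1r subrr scale0r addr0 mul1r.
Qed.

Lemma sqrt3_bounds (R : realType) : 1 <= Num.sqrt (3 : R) <= 2.
Proof.
by rewrite -[X in X <= _ <= _]sqrtr1 -[X in _ <= _ <= X](ger0_norm (x := 2))//
  -sqrtr_sqr !ler_sqrt ?exprn_ge0//; apply/andP; split; lra.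
Qed.

(** A competitor has diameter [k s] while [K] contains [ab], so their Hausdorff distance is at least
    [(1 - k) s / 2]. For the upper bound, the contracted triangle is a competitor within distance
    [s] of [K]. *)
Lemma clipped_triangle_asymmetry (R : realType) (a b c : plane R) (s k : R) :
  equilateral a b c s -> 1 / 2 <= k -> k <= 1 ->
  (1 - k) / 2 <=
    hausdorff_width_asymmetry (triangle a b (k *: c + (1 - k) *: a)) <= 4.
Proof.
move=> abc k2 k1; have k0 : 0 < k by lra.
have wK := clipped_triangle_width abc k0 k1.
have KT := @clipped_triangle_subset R a b c k k0 k1.
set K := triangle a b _ in wK KT *.
have /andP[r1 r2] := sqrt3_bounds R.
have [s0 ab bc ca] := abc.
have h0 : 0 < Num.sqrt 3 / 2 * s by nra.
have w0 : 0 < width K by rewrite wK mulr_gt0.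
have T'wK := equilateral_width (equilateral_contraction abc k0).
set b' := k *: b + _ in T'wK; set c' := k *: c + _ in T'wK.
have T'eq : equilateral_triangle (triangle a b' c').
  apply/equilateral_triangleP; exists a, b', c', (k * s).
  by split => //; exact: equilateral_contraction.
have lb T : equilateral_triangle T -> width T = width K ->
    (1 - k) / 2 <= hausdorff_dist K T / width K.
  move=> /equilateral_triangleP[p [q [r [t [pqr ->]]]]].
  rewrite (equilateral_width pqr) wK => tE.
  have {}tE : t = k * s.
    by apply: (@mulfI _ (Num.sqrt 3 / 2)); [rewrite gt_eqF//; lra|rewrite tE; ring].
  rewrite ler_pdivlMr; last by rewrite -wK.
  have [_ pq qr rp] := pqr.
  have := @hausdorff_dist_ge R a b (k *: c + (1 - k) *: a) a b (triangle p q r) t.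
  rewrite ab => /(_ _ _ (triangle_mem1 _ _ _) (triangle_mem2 _ _ _)).
  have ex : triangle p q r !=set0 by exists p; exact: triangle_mem1.
  have dm z w : triangle p q r z -> triangle p q r w -> enorm (z - w) <= t.
    by apply: triangle_diam_le; rewrite ?pq ?qr ?rp.
  move=> /(_ ex dm); rewrite -/K tE.
  (* The width of [K] is at most [s], because [k <= 1] and [Num.sqrt 3 <= 2]. *)
  have : (1 - k) / 2 * (k * (Num.sqrt 3 / 2 * s)) <= (1 - k) / 2 * s.
    rewrite ler_wpM2l//; first by lra.
    rewrite mulrA -[leRHS]mul1r ler_wpM2r ?(ltW s0)//; nra.
  by lra.
apply/andP; split.
  apply: lb_le_inf.
    exists (hausdorff_dist K (triangle a b' c') / width K), (triangle a b' c') => //.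
    by split => //; rewrite T'wK wK; ring.
  by move=> _ [T [hT wT] <-]; exact: lb.
apply: (@le_trans _ _ (hausdorff_dist K (triangle a b' c') / width K)).
  apply: ge_inf; first by exists ((1 - k) / 2) => _ [T [hT wT] <-]; exact: lb.
  by exists (triangle a b' c') => //; split => //; rewrite T'wK wK; ring.
(* The constant [4] arises because [k >= 1 / 2] and [Num.sqrt 3 >= 1] make the width of [K] at least
   [s / 4]. *)
rewrite ler_pdivrMr// wK; apply: (@le_trans _ _ s); last by nra.
apply: hausdorff_dist_le; [by exists a; exact: triangle_mem1
  |by exists a; exact: triangle_mem1|].
move=> x y /KT hx hy; apply: (triangle_diam_le (a := a) (b := b) (c := c));
  rewrite ?ab ?bc ?ca//.
apply: triangle_subset hy; [exact: triangle_mem1| |];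
  (apply: triangle_convex; [exact: ltW|by []| |exact: triangle_mem1]);
  by [exact: triangle_mem2|exact: triangle_mem3].
Qed.

(** * Cheeger constant and deficit under inclusion *)

Lemma cheeger_antimono (R : realType) (K L : set (plane R)) :
  K `<=` L -> (cheeger L <= cheeger K)%E.
Proof.
move=> KL; apply: ereal_inf_le_tmp => _ [E [mE EK E0] <-].
by exists E => //; split => //; exact: subset_trans KL.
Qed.

(* An infinite Cheeger constant makes the deficit [-oo], since [+oo - +oo = -oo]
   in [\bar R]. *)
Lemma width_cheeger_deficit_le (R : realType) (T K : set (plane R)) :
  K `<=` T -> 0 < width K -> width K <= width T ->
  (width_cheeger_deficit T K <=
     ((width T - width K) * `|fine (cheeger T)|)%:E)%E.
Proof.
move=> /cheeger_antimono; rewrite /width_cheeger_deficit.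
move: (width T) (width K) (cheeger T) (cheeger K) => t w + + + w0 wt.
have t0 : 0 < t by exact: lt_le_trans wt.
move=> [h||] [h'||]; rewrite ?lee_fin ?leye_eq//= => hh';
  rewrite ?gt0_muley ?gt0_muleNy ?lte_fin// ?addeNy ?addNye ?leNye//.
have : w * h <= w * h' by rewrite ler_pM2l.
have : (t - w) * h <= (t - w) * `|h| by rewrite ler_wpM2l ?ler_norm ?subr_ge0.
lra.
Qed.

(** * Choice of the parameter and conclusion *)

(** For [0 <= p < 1] the lower bound on [x] makes [x^p] at least of order [e^p], which dominates [e]
    near [0]; for [p < 0] the upper bound on [x] keeps [x^p] above the constant [4^p]. *)
Lemma powR_dominates_linear (R : realType) (p B D : R) : p < 1 -> 0 < D ->
  exists2 e : R, 0 < e <= 1 / 2 &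
    e < D /\ forall x, e / 2 <= x <= 4 -> B * e < x `^ p.
Proof.
move=> p1 D0.
have M0 : 0 < 2 * `|B| + 1 by rewrite ltr_wpDl// mulr_ge0.
have p4 : 0 < 4 `^ p :> R by rewrite powR_gt0.
have q0 : 0 < 1 / 4 :> R by lra.
have D20 : 0 < D / 2 by lra.
have near_pow : \forall t \near (0 : R)^'+, t `^ (1 - p) < (2 * `|B| + 1)^-1.
  apply: (cvgr_lt _ (powR_cvg0 _)); [by rewrite subr_gt0|by rewrite invr_gt0].
(* Here [e = 2 t]: the bounds [1 / 4] and [D / 2] give [e <= 1 / 2] and [e < D], the bound with
   [4^p] serves [p < 0], and the last one serves [p >= 0]. *)
have [t [t0 t4 tD tB tp]] : exists t : R, [/\ 0 < t, t < 1 / 4, t < D / 2,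
    t < 4 `^ p / (2 * `|B| + 1) & t `^ (1 - p) < (2 * `|B| + 1)^-1].
  apply: (@filter_ex _ (0 : R)^'+); near=> t; split; near: t => //.
  - exact: nbhs_right_gt.
  - exact: nbhs_right_lt.
  - exact: nbhs_right_lt.
  - by apply: nbhs_right_lt; exact: divr_gt0.
exists (2 * t); first by apply/andP; split; lra.
split=> [|x /andP[tx x4]]; first by lra.
have {}tx : t <= x by lra.
have Bt : B * (2 * t) <= 2 * `|B| * t.
  by have := ler_norm B; nra.
apply: (le_lt_trans Bt).
have x0 : 0 < x by exact: lt_le_trans tx.
have [pge|plt] := leP 0 p.
  apply: (@lt_le_trans _ _ (t `^ p)); last first.
    by apply: ge0_ler_powR; rewrite // nnegrE ltW.
  (* Factoring out [t^p] leaves [2 |B| t^(1 - p)], which is below [1] by the choice of [t]. *)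
  have tE : t = t `^ p * t `^ (1 - p).
    rewrite -powRD; last by rewrite (gt_eqF t0) implybT.
    by rewrite addrC subrK powRr1// ltW.
  rewrite {1}tE mulrCA -[ltRHS]mulr1 ltr_pM2l ?powR_gt0//.
  by move: tp; rewrite -div1r ltr_pdivlMr//; have := powR_gt0 (1 - p) t0; nra.
apply: (@lt_le_trans _ _ (4 `^ p)).
  by move: tB; rewrite ltr_pdivlMr//; nra.
rewrite -[p]opprK powRN [leRHS]powRN lef_pV2 ?posrE ?powR_gt0//.
by apply: ge0_ler_powR; rewrite // ?nnegrE ?oppr_ge0 ltW.
Unshelve. all: end_near. Qed.

Theorem proposition4p7 (R : realType) (Te : set (plane R))
    (hTe : equilateral_triangle Te)
    (eta : R) (eta_gt0 : 0 < eta) (eta_lt : eta < 3 `^ (1 / 4) * pi `^ (1 / 2))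
    (p : R) (p_lt1 : p < 1) :
  ~ exists C : R, 0 < C /\
      forall K : set (plane R), convex_body K ->
        (width_cheeger_deficit Te K < eta%:E)%E ->
        ((hausdorff_width_asymmetry K `^ p)%:E
           <= C%:E * width_cheeger_deficit Te K)%E.
Proof.
move=> [C [C0 ineq]].
have /equilateral_triangleP[a [b [c [s [abc TeE]]]]] := hTe.
have wTe := equilateral_width abc; rewrite -TeE in wTe.
have wTe0 : 0 < width Te.
  have [s0 _ _ _] := abc; have /andP[r1 _] := sqrt3_bounds R.
  by rewrite wTe mulr_gt0//; lra.
(* The deficit of the clipped triangle will be at most [e * A]; the absolute value makes [A]
   nonnegative. *)
pose A := width Te * `|fine (cheeger Te)|.
have A0 : 0 <= A by rewrite mulr_ge0// ltW.
have A1 : 0 < A + 1 by rewrite ltr_wpDl.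
(* The threshold [eta / (A + 1)] keeps [e * A] below [eta], and the slope [C * A] makes the [p]-th
   power of the asymmetry exceed [C] times the deficit bound. *)
have [e /andP[e0 e2] [eD powp]] :=
  powR_dominates_linear (C * A) p_lt1 (divr_gt0 eta_gt0 A1).
have k0 : 0 < 1 - e by lra.
have k1 : 1 - e <= 1 by lra.
pose K := triangle a b ((1 - e) *: c + (1 - (1 - e)) *: a).
have wK : width K = (1 - e) * width Te.
  by rewrite wTe; exact: clipped_triangle_width.
have KTe : K `<=` Te by rewrite TeE; exact: clipped_triangle_subset.
have wKT : width K <= width Te by rewrite wK; nra.
have wK0 : 0 < width K by rewrite wK mulr_gt0.
have := width_cheeger_deficit_le KTe wK0 wKT.
have -> : (width Te - width K) * `|fine (cheeger Te)| = e * A.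
  by rewrite wK /A; ring.
move=> defle.
have eA : e * A < eta by move: eD; rewrite ltr_pdivlMr//; nra.
have Kb : convex_body K by exact: clipped_triangle_convex_body abc k0.
have deflt : (width_cheeger_deficit Te K < eta%:E)%E.
  by apply: (le_lt_trans defle); rewrite lte_fin.
have := ineq K Kb deflt.
apply/negP; rewrite -ltNge.
apply: (@le_lt_trans _ _ (C * A * e)%:E).
  have -> : C * A * e = C * (e * A) by ring.
  by rewrite [leRHS]EFinM; apply: lee_wpmul2l; rewrite ?lee_fin// ltW.
rewrite lte_fin; apply: powp.
have -> : e / 2 = (1 - (1 - e)) / 2 by congr (_ / 2); ring.
by apply: clipped_triangle_asymmetry abc _ k1; lra.
Qed.
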